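(* (Decomposition) There is a decomposition isomorphism $$\Phi_{\mathrm{tffr}}\colon K_0(\mathfrak{sl}(2)\text{-}\mathrm{Mod}_{\mathrm{tffr}})\xrightarrow{\sim}\bigoplus_{\mu\in\mathbb C}K_0(\mathcal C^\bullet_{\mu,\mathrm{tffr}})$$ given by $\Phi_{\mathrm{tffr}}([V])=\sum_{i=1}^p[V_{\mu_i}]$, where, if $(V,\rho)\in\mathfrak{sl}(2)\text{-}\mathrm{Mod}_{\mathrm{tffr}}$ and $M_{C_\rho}(t)=(t-\mu_1)^{n_1}\cdots(t-\mu_p)^{n_p}\in\mathbb C[t]$ (with the $\mu_i$ pairwise distinct) is the minimal polynomial of its Casimir operator $C_\rho$, the modules $V_{\mu_i}=\ker(C_\rho-\mu_i)^{n_i}\in\mathcal C^\bullet_{\mu_i,\mathrm{tffr}}$ are the factors of the decomposition $V=V_{\mu_1}\oplus\cdots\oplus V_{\mu_p}$ of $V$ into a direct sum of $\mathfrak{sl}(2)$-submodules. There is also a decomposition isomorphism $$\Psi_{\mathrm{tffr}}\colon \mathbb Z[\widehat{\mathrm{PSpl}}(\mathfrak{sl}(2))]\xrightarrow{\sim}\bigoplus_{\mu\in\mathbb C}\mathbb Z[\widehat{\mathrm{PSpl}}(\mathfrak{sl}(2))_\mu].$$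
   Context: $\mathfrak{sl}(2)\text{-}\mathrm{Mod}_{\mathrm{tffr}}$ is the (essentially small, exact) category of $\mathfrak{sl}(2)$-modules that are torsion free of finite rank as $\mathbb C[z]$-modules, where $z$ acts by $L_0=-\tfrac12 h$. The Casimir operator $C_\rho$ of a module $(V,\rho)$ in this category has a minimal polynomial with coefficients in $\mathbb C$, and the category decomposes as the Hom-orthogonal direct sum $\bigoplus_{\mu\in\mathbb C}\mathcal C^\bullet_{\mu,\mathrm{tffr}}$, where $\mathcal C^\bullet_{\mu,\mathrm{tffr}}$ is the full subcategory of torsion free finite rank generalized Casimir modules of level $\mu$ (i.e. $(C_\rho-\mu)^n=0$ for some $n$). $K_0$ denotes the Grothendieck group of an essentially small exact category. $\mathrm{PSpl}(\mathfrak{sl}(2))$ is the category of purely irreducible $\mathfrak{sl}(2)$-modules (finite rank torsion free modules with no proper nonzero pure $\mathfrak{sl}(2)$-submodules, equivalently whose rationalization $S^{-1}V$, $S=\mathbb C[z]\setminus\{0\}$, is irreducible in the category of rational $\mathfrak{sl}(2)$-modules); these are Casimir modules, and $\mathrm{PSpl}(\mathfrak{sl}(2))_\mu$ denotes those of level $\mu$. A hat denotes the set of isomorphism classes, and $\mathbb Z[X]$ the free abelian group on $X$. *)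

(* Defs.v *)
From mathcomp Require Import all_boot all_algebra.
From mathcomp.real_closed Require Import complex.
From mathcomp Require Import Rstruct.
From Stdlib Require List.
From Stdlib Require Import Permutation.
Set Implicit Arguments. Unset Strict Implicit. Unset Printing Implicit Defensive.
Import GRing.Theory.
Local Open Scope ring_scope.

Definition CC : fieldType := complex Rdefinitions.R.

Record smod := SMod {
  car : lmodType CC;
  sE : {linear car -> car};
  sF : {linear car -> car};
  sH : {linear car -> car};
  _ : forall v, sH (sE v) - sE (sH v) = 2%:R *: sE v;
  _ : forall v, sH (sF v) - sF (sH v) = - (2%:R *: sF v);
  _ : forall v, sE (sF v) - sF (sE v) = sH v }.

Section SModDefs.
Variable V : smod.

(* z acts by L_0 = -1/2 h *)
Definition zact (v : car V) : car V := - ((2%:R : CC)^-1 *: sH V v).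

Definition pact (p : {poly CC}) (v : car V) : car V :=
  \sum_(i < size p) p`_i *: iter i zact v.

Definition torsion_free : Prop :=
  forall (p : {poly CC}) (v : car V), p != 0 -> pact p v = 0 -> v = 0.

(* finite rank: V is (up to torsion) spanned over CC[z] by finitely many
   elements, i.e. S^{-1}V is finite dimensional over CC(z). *)
Definition finite_rank : Prop :=
  exists s : seq (car V), forall v : car V,
    exists p : {poly CC}, p != 0 /\
      exists qs : seq {poly CC}, size qs = size s /\
        pact p v = \sum_(i < size s) pact qs`_i s`_i.

Definition casimir (v : car V) : car V :=
  sE V (sF V v) + sF V (sE V v) + (2%:R : CC)^-1 *: sH V (sH V v).

Definition casimir_shift (mu : CC) (v : car V) : car V := casimir v - mu *: v.

Definition gen_casimir (mu : CC) : Prop :=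
  exists n : nat, forall v : car V, iter n (casimir_shift mu) v = 0.

Definition casimir_level (mu : CC) : Prop :=
  forall v : car V, casimir v = mu *: v.

Definition submod (U : car V -> Prop) : Prop :=
  U 0 /\ (forall (a : CC) x y, U x -> U y -> U (a *: x + y)) /\
  (forall x, U x -> U (sE V x) /\ U (sF V x) /\ U (sH V x)).

Definition pure (U : car V -> Prop) : Prop :=
  forall (p : {poly CC}) (v : car V), p != 0 -> U (pact p v) -> U v.

End SModDefs.

Definition shom (V W : smod) (f : car V -> car W) : Prop :=
  (forall (a : CC) x y, f (a *: x + y) = a *: f x + f y) /\
  (forall v, f (sE V v) = sE W (f v)) /\
  (forall v, f (sF V v) = sF W (f v)) /\
  (forall v, f (sH V v) = sH W (f v)).

Definition siso (V W : smod) : Prop :=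
  exists f : car V -> car W, shom f /\ bijective f.

Definition ses (A B C : smod) (i : car A -> car B) (p : car B -> car C) : Prop :=
  shom i /\ shom p /\ injective i /\ (forall c, exists b, p b = c) /\
  (forall b, p b = 0 <-> exists a, i a = b).

Definition tffr (V : smod) : Prop := torsion_free V /\ finite_rank V.

Definition Cmu (mu : CC) (V : smod) : Prop := tffr V /\ gen_casimir V mu.

Definition PSpl (V : smod) : Prop :=
  tffr V /\ (exists v : car V, v != 0) /\
  forall U : car V -> Prop, submod U -> pure U ->
    (exists v, U v /\ v != 0) -> forall v, U v.

Definition PSpl_mu (mu : CC) (V : smod) : Prop := PSpl V /\ casimir_level V mu.

(* Formal Z-linear combinations of objects: sum of n_i [X_i]. *)
Definition fsum := seq (int * smod).

Definition fvalid (P : smod -> Prop) (x : fsum) : Prop :=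
  List.Forall (fun c => P c.2) x.

(* K_0 of the exact full subcategory P: free abelian group on objects modulo
   [B] = [A] + [C] for each short exact sequence with A, B, C in P
   (isomorphic objects get identified through such sequences). *)
Inductive k0eq (P : smod -> Prop) : fsum -> fsum -> Prop :=
  | k0_refl x : k0eq P x x
  | k0_sym x y : k0eq P x y -> k0eq P y x
  | k0_trans x y z : k0eq P x y -> k0eq P y z -> k0eq P x z
  | k0_perm x y : Permutation x y -> k0eq P x y
  | k0_app s x y : k0eq P x y -> k0eq P (s ++ x) (s ++ y)
  | k0_merge (m n : int) X s : k0eq P ((m, X) :: (n, X) :: s) ((m + n, X) :: s)
  | k0_zero X s : k0eq P ((0, X) :: s) s
  | k0_ses A B C (i : car A -> car B) (p : car B -> car C) s :
      P A -> P B -> P C -> ses i p ->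
      k0eq P ((1, B) :: s) ((1, A) :: (1, C) :: s).

(* Z[hat P]: free abelian group on isomorphism classes of objects in P. *)
Inductive freq (P : smod -> Prop) : fsum -> fsum -> Prop :=
  | fr_refl x : freq P x x
  | fr_sym x y : freq P x y -> freq P y x
  | fr_trans x y z : freq P x y -> freq P y z -> freq P x z
  | fr_perm x y : Permutation x y -> freq P x y
  | fr_app s x y : freq P x y -> freq P (s ++ x) (s ++ y)
  | fr_merge (m n : int) X s : freq P ((m, X) :: (n, X) :: s) ((m + n, X) :: s)
  | fr_zero X s : freq P ((0, X) :: s) s
  | fr_iso (n : int) X Y s : P X -> P Y -> siso X Y ->
      freq P ((n, X) :: s) ((n, Y) :: s).

Definition dsum := CC -> fsum.

Definition dvalid (Pmu : CC -> smod -> Prop) (D : dsum) : Prop :=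
  (forall mu, fvalid (Pmu mu) (D mu)) /\
  exists L : seq CC, forall mu, mu \notin L -> D mu = [::].

Definition deq (Rel : (smod -> Prop) -> fsum -> fsum -> Prop)
  (Pmu : CC -> smod -> Prop) (D D' : dsum) : Prop :=
  forall mu, Rel (Pmu mu) (D mu) (D' mu).

(* Phi induces a group isomorphism  (fsum / Rel P)  ~=  (+)_mu (fsum / Rel (Pmu mu)) *)
Definition group_iso (Rel : (smod -> Prop) -> fsum -> fsum -> Prop)
  (P : smod -> Prop) (Pmu : CC -> smod -> Prop) (Phi : fsum -> dsum) : Prop :=
  (forall x, fvalid P x -> dvalid Pmu (Phi x)) /\
  (forall x y, fvalid P x -> fvalid P y -> Rel P x y -> deq Rel Pmu (Phi x) (Phi y)) /\
  (forall x y, fvalid P x -> fvalid P y ->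
     deq Rel Pmu (Phi (x ++ y)) (fun mu => Phi x mu ++ Phi y mu)) /\
  (forall x y, fvalid P x -> fvalid P y -> deq Rel Pmu (Phi x) (Phi y) -> Rel P x y) /\
  (forall D, dvalid Pmu D -> exists x, fvalid P x /\ deq Rel Pmu (Phi x) D).

(* Main.v *)
Require Import Defs.
From HB Require Import structures.
From mathcomp Require Import all_boot all_algebra.
From mathcomp.real_closed Require Import complex.
From mathcomp Require Import boolp Rstruct zify.
From Stdlib Require List.
From Stdlib Require Import Permutation.
Set Implicit Arguments. Unset Strict Implicit. Unset Printing Implicit Defensive.
Import GRing.Theory Num.Theory.
Local Open Scope ring_scope.

(** The Casimir operator [C] is CC[z]-linear, so on a module of finite rank it is
    annihilated by some nonzero [P(z, C)] (Cramer's rule).  [E] intertwines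
    [P(z, C)] with [P(z + 1, C)] and is injective, so the annihilators are stable
    under [z -> z - 1]; differencing in [z] lowers degrees until only an annihilator
    [q(C)] with constant coefficients is left.  Bezout identities for coprime factors of [q]
    give idempotents in CC[C] projecting onto the generalized Casimir
    eigenspaces; these commute with sl(2), are exact, and vanish outside the
    roots of [q], whence the decomposition of K_0.  For [V] purely
    irreducible, the kernel of [C - mu] is pure, and nonzero for some root
    [mu] of [q], hence is all of [V]. *)

(** Torsion freeness passes to submodules, while finite rank, given by elements that span up to
    torsion, passes directly to quotients. The pieces of [V] are therefore always obtained as direct
    summands, which are both. The passage from modules to groups rests on one explicit inverse:
    components are summed over a finite list of levels that contains the support. This argument is
    the same for [k0eq] and [freq], so it is carried out once, for an arbitrary assignment of
    components to objects and for any relation with the closure rules common to both. *)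

(* [V] with its module structure over {poly K} in which 'X acts as [z]. *)
Definition pmod (K : comNzRingType) (V : lmodType K) (z : {linear V -> V}) : Type := V.
HB.instance Definition _ (K : comNzRingType) (V : lmodType K) (z : {linear V -> V}) :=
  GRing.Zmodule.on (pmod z).

(** * Polynomials in an endomorphism *)

Section PolyModule.
Variables (K : comNzRingType) (V : lmodType K) (z : {linear V -> V}).

(** With [zact] for [z] this is [pact]. With the Casimir operator it is q(C) over the scalars CC and
    P(z, C) over the scalars CC[z]. *)
Definition pscale (p : {poly K}) (v : V) : V := \sum_(i < size p) p`_i *: iter i z v.

Lemma pscale_widen n (p : {poly K}) v : (size p <= n)%N ->
  pscale p v = \sum_(i < n) p`_i *: iter i z v.
Proof.
move=> le_pn; rewrite /pscale (big_ord_widen n (fun i => p`_i *: iter i z v)) //.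
rewrite big_mkcond; apply: eq_bigr => i _; case: ltnP => // /(nth_default 0) ->.
by rewrite scale0r.
Qed.

Lemma iter_linear n (a : K) (u v : V) :
  iter n z (a *: u + v) = a *: iter n z u + iter n z v.
Proof. by elim: n => //= n ->; rewrite linearP. Qed.

Lemma pscale_linear (a : K) p (u v : V) :
  pscale p (a *: u + v) = a *: pscale p u + pscale p v.
Proof.
rewrite /pscale scaler_sumr -big_split; apply: eq_bigr => i _ /=.
by rewrite iter_linear scalerDr !scalerA mulrC.
Qed.

Lemma pscaleDl v : {morph pscale^~ v : p q / p + q >-> p + q}.
Proof.
move=> p q; pose n := maxn (size p) (size q).
rewrite (@pscale_widen n (p + q)) ?size_polyD // (@pscale_widen n p) ?leq_maxl //.
rewrite (@pscale_widen n q) ?leq_maxr // -big_split; apply: eq_bigr => i _ /=.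
by rewrite coefD scalerDl.
Qed.

Lemma pscaleZl a p v : pscale (a *: p) v = a *: pscale p v.
Proof.
rewrite (@pscale_widen (size p)) ?size_scale_leq // scaler_sumr.
by apply: eq_bigr => i _; rewrite coefZ scalerA.
Qed.

Lemma pscaleMX p v : pscale (p * 'X) v = pscale p (z v).
Proof.
rewrite (@pscale_widen (size p).+1).
  rewrite big_ord_recl coefMX eqxx scale0r add0r; apply: eq_bigr => i _.
  by rewrite coefMX /= -iterSr.
by apply: leq_trans (size_polyMleq _ _) _; rewrite size_polyX addn2.
Qed.

Lemma pscale_comm p v : pscale p (z v) = z (pscale p v).
Proof.
rewrite /pscale linear_sum; apply: eq_bigr => i _.
by rewrite linearZ /= -iterSr -iterS.
Qed.

Lemma pscaleC a v : pscale a%:P v = a *: v.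
Proof.
by rewrite (@pscale_widen 1) ?size_polyC ?leq_b1 // big_ord1 coefC.
Qed.

Lemma pscaleA p q v : pscale p (pscale q v) = pscale (p * q) v.
Proof.
elim/poly_ind: p v => [|p a IHp] v.
  by rewrite mul0r -[0]/(0%:P) !pscaleC !scale0r.
rewrite pscaleDl pscaleMX pscaleC mulrDl pscaleDl mul_polyC pscaleZl -pscale_comm.
by rewrite IHp mulrAC pscaleMX.
Qed.

HB.instance Definition _ p :=
  GRing.isLinear.Build K V V *:%R (pscale p) (fun a => pscale_linear a p).

Lemma pscale1 v : pscale 1 v = v.
Proof. by rewrite -[1]/(1%:P) pscaleC scale1r. Qed.

Lemma pscale0 v : pscale 0 v = 0.
Proof. by rewrite -[0]/(0%:P) pscaleC scale0r. Qed.

Lemma pscaleBl p q v : pscale (p - q) v = pscale p v - pscale q v.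
Proof. by rewrite pscaleDl -[- q]scaleN1r pscaleZl scaleN1r. Qed.

Lemma pscaleX v : pscale 'X v = z v.
Proof. by rewrite -['X]mul1r pscaleMX pscale1. Qed.

Lemma pscale_eigen (p : {poly K}) a (v : V) : z v = a *: v ->
  pscale p v = p.[a] *: v.
Proof.
move=> zv; elim/poly_ind: p => [|p b IHp]; first by rewrite horner0 pscale0 scale0r.
rewrite pscaleDl pscaleMX zv pscaleC linearZ /= IHp hornerMXaddC scalerDl.
by rewrite scalerA mulrC.
Qed.


Fact pscaleDr : right_distributive pscale +%R.
Proof. by move=> p u v; rewrite linearD. Qed.

HB.instance Definition _ :=
  GRing.Zmodule_isLmodule.Build {poly K} (pmod z) pscaleA pscale1 pscaleDr pscaleDl.

Lemma pmod_scaleE (p : {poly K}) (v : pmod z) : p *: v = pscale p v.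
Proof. by []. Qed.

(** If f z = (z + a) f, then f p(z) = p(z + a) f. It serves for E with a = 1 and for F with a =
    -1. *)
Lemma pscale_shift (f : {linear V -> V}) a : (forall v, f (z v) = z (f v) + a *: f v) ->
  forall p v, f (pscale p v) = pscale (p \Po ('X + a%:P)) (f v).
Proof.
move=> fz p; elim/poly_ind: p => [|p b IHp] v.
  by rewrite comp_poly0 !pscale0 linear0.
rewrite comp_polyD comp_polyM comp_polyX comp_polyC !pscaleDl pscaleMX !pscaleC.
by rewrite linearD linearZ /= IHp fz -pscaleA pscaleDl pscaleX pscaleC.
Qed.

End PolyModule.

(** The twist [s] covers three situations: E, which shifts the coefficients in z; homomorphisms over
    CC, with [s] the identity; and the inclusion of CC into CC[z], with [f] the identity. *)
Lemma pscale_semilinear (K L : comNzRingType) (V : lmodType K) (W : lmodType L)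
    (z : {linear V -> V}) (w : {linear W -> W}) (s : {rmorphism K -> L})
    (f : V -> W) :
    {morph f : u v / u + v} ->
    (forall a v, f (a *: v) = s a *: f v) -> (forall v, f (z v) = w (f v)) ->
  forall (p : {poly K}) (v : V), f (pscale z p v) = pscale w (map_poly s p) (f v).
Proof.
move=> fD fZ fz p; elim/poly_ind: p => [|p a IHp] v.
  by rewrite rmorph0 !pscale0 -[X in f X](scale0r 0) fZ rmorph0 scale0r.
rewrite rmorphD rmorphM /= map_polyX map_polyC /= !pscaleDl !pscaleMX fD !pscaleC.
by rewrite fZ IHp fz.
Qed.

(** * Cramer's rule on modules of finite rank *)

Lemma det_annihilates (R : comNzRingType) (V : lmodType R) n (A : 'M[R]_n)
    (s : 'I_n -> V) :
  (forall i, \sum_j A i j *: s j = 0) -> forall k, \det A *: s k = 0.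
Proof.
move=> As0 k.
have: \sum_j (\adj A *m A) k j *: s j = 0.
  under eq_bigr do rewrite mxE scaler_suml.
  rewrite exchange_big big1 // => i _ /=.
  under eq_bigr do rewrite -scalerA.
  by rewrite -scaler_sumr As0 scaler0.
rewrite mul_adj_mx (bigD1 k) //= big1 => [|j /negPf ne_jk].
  by rewrite addr0 mxE eqxx.
by rewrite mxE eq_sym ne_jk scale0r.
Qed.

Section Annihilator.
Variables (K : idomainType) (V : lmodType K) (c : {linear V -> V}).

Definition annihilates (p : {poly K}) := forall v : V, pscale c p v = 0.

Hypothesis tfV : forall (a : K) (v : V), a != 0 -> a *: v = 0 -> v = 0.

(** The determinant kills the spanning elements by Cramer's rule; any other vector has a nonzero
    multiple in their span, so torsion freeness finishes. *)
Lemma finite_rank_annihilator (n : nat) (s : 'I_n -> V) :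
    (forall v, exists a : K, a != 0 /\
       exists q : 'I_n -> K, a *: v = \sum_i q i *: s i) ->
  exists2 p : {poly K}, p != 0 & annihilates p.
Proof.
move=> span.
have /choice [a] : forall i, exists a : K,
    a != 0 /\ exists q : 'I_n -> K, a *: c (s i) = \sum_j q j *: s j.
  by move=> i; apply: span.
move=> aP; have a0 i : a i != 0 by case: (aP i).
have /choice [q qP] : forall i, exists q : 'I_n -> K,
    a i *: c (s i) = \sum_j q j *: s j.
  by move=> i; case: (aP i).
(* The relation for [c (s i)] holds only after multiplication by [a i], so row [i] of the
   characteristic matrix is scaled by [a i] to keep its entries in [{poly K}]. *)
pose D : 'M[{poly K}]_n := \matrix_(i, j) ((a i *+ (i == j)) *: 'X - (q i j)%:P).
have Ds k : pscale c (\det D) (s k) = 0.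
  apply: (@det_annihilates _ (pmod c) n D s _ k) => i.
  transitivity (\sum_j (a i *+ (i == j) *: c (s j) - q i j *: s j)).
    by apply: eq_bigr => j _; rewrite mxE pmod_scaleE pscaleBl pscaleZl pscaleX pscaleC.
  rewrite sumrB -qP (bigD1 i) //= eqxx big1 => [|j ne_ji]; first by rewrite addr0 subrr.
  by rewrite eq_sym (negPf ne_ji) scale0r.
exists (\det D); last first.
  move=> v; have [b [b0 [r rP]]] := span v.
  apply: (tfV b0); rewrite -linearZ /= rP linear_sum big1 // => i _.
  by rewrite linearZ /= Ds scaler0.
(* Over the fraction field, [D] is an invertible diagonal matrix times a characteristic matrix,
   whose determinant is monic; hence [\det D] is nonzero. *)
pose toF := @tofrac K; pose M := \matrix_(i < n, j < n) (toF (q i j) / toF (a i)).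
have toFa i : toF (a i) != 0 by rewrite tofrac_eq0.
have mapD : map_mx (map_poly toF) D =
    diag_mx (\row_i (toF (a i))%:P) *m char_poly_mx M.
  apply/matrixP=> i j; rewrite mul_diag_mx !mxE rmorphB /= map_polyC /= -mul_polyC.
  rewrite rmorphM /= map_polyX map_polyC /= rmorphMn mulrBr -polyCM.
  rewrite [_ * (_ / _)]mulrC divfK //.
  by case: eqP => _; rewrite ?mulr1n ?mulr0n ?mulr0 ?mul0r ?polyC0 ?mul0r.
apply/eqP => D0; have := congr1 (map_poly toF) D0.
rewrite rmorph0 -det_map_mx mapD det_mulmx det_diag => /eqP.
rewrite mulf_eq0 (negPf (monic_neq0 (char_poly_monic M))) orbF prodf_seq_eq0.
by case/hasP => i _ /=; rewrite mxE polyC_eq0 (negPf (toFa i)).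
Qed.
End Annihilator.

(** * Translations of polynomials in characteristic zero *)

Section Shift.
Variable K : numFieldType.
Implicit Type p : {poly K}.

(** Translation keeps the degree and the leading coefficient, so the top terms cancel. *)
Lemma size_sub_shift p (a : K) : p != 0 ->
  (size (p - (p \Po ('X + a%:P)))%R < size p)%N.
Proof.
move=> p0; set q := p \Po _.
have sq : size q = size p by exact: (size_comp_poly2 _ (size_XaddC a)).
have lq : lead_coef q = lead_coef p.
  by rewrite lead_coef_comp ?size_XaddC // lead_coefXaddC expr1n mulr1.
rewrite -[X in (_ < X)%N]prednK ?size_poly_gt0 // ltnS.
apply/leq_sizeP => j; rewrite leq_eqVlt => /predU1P [<-|lt_j].
  by rewrite coefB -[p`__]/(lead_coef p) -lq /lead_coef sq subrr.
have le_j : (size p <= j)%N by rewrite -(ltn_predK (_ : 0 < size p)%N) ?size_poly_gt0.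
by rewrite coefB !nth_default ?sq ?subrr.
Qed.

(** An invariant polynomial takes the value p(0) at 0, -1, -2, ..., which are infinitely many
    points. *)
Lemma shift_fixed_const p : p \Po ('X - 1%:P) = p -> (size p <= 1)%N.
Proof.
move=> fix_p; have pn n : p.[- n%:R] = p.[0].
  elim: n => [|n IHn]; first by rewrite oppr0.
  rewrite -IHn -[in RHS]fix_p horner_comp !hornerE; congr (_.[_]).
  by rewrite -natr1 opprD.
suff: p - (p.[0])%:P == 0 by rewrite subr_eq0 => /eqP ->; exact: size_polyC_leq1.
apply/negPn/negP => q0.
have := @max_poly_roots _ _ [seq - n%:R | n <- iota 0 (size (p - (p.[0])%:P))] q0.
rewrite size_map size_iota ltnn => H; suff: false by []; apply: H.
  by apply/allP => _ /mapP [n _ ->]; rewrite /root !hornerE pn subrr.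
rewrite map_inj_uniq ?iota_uniq // => m n /oppr_inj /eqP.
by rewrite eqr_nat => /eqP.
Qed.

End Shift.

(** [CC] is declared only as a [fieldType]; characteristic zero is read off from the numeric
    structure of [complex]. *)
Lemma CC_eqr_nat m n : ((m%:R : CC) == n%:R) = (m == n).
Proof. exact: (@eqr_nat (complex Rdefinitions.R)). Qed.

Lemma CC_natr_eq0 n : ((n%:R : CC) == 0) = (n == 0%N).
Proof. exact: (@pnatr_eq0 (complex Rdefinitions.R)). Qed.

(** * The Casimir operator and its annihilators *)

Section Sl2.
Variable V : smod.
Implicit Type v : car V.

Fact zact_linear : linear (@zact V).
Proof.
move=> a u v; rewrite /zact linearP scalerDr opprD scalerN; congr (- _ - _).
by rewrite !scalerA mulrC.
Qed.
HB.instance Definition _ :=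
  GRing.isLinear.Build CC (car V) (car V) *:%R (@zact V) zact_linear.

Fact casimir_linear : linear (@casimir V).
Proof.
move=> a u v; rewrite /casimir !linearP /= !scalerDr.
by rewrite [RHS]addrACA [X in _ = X + _]addrACA.
Qed.
HB.instance Definition _ :=
  GRing.isLinear.Build CC (car V) (car V) *:%R (@casimir V) casimir_linear.

Lemma two_neq0 : (2%:R : CC) != 0.
Proof. by rewrite CC_natr_eq0. Qed.

Lemma sHE v : sH V v = - (2%:R *: zact v).
Proof. by rewrite /zact scalerN opprK scalerA mulfV ?two_neq0 // scale1r. Qed.

Lemma sE_zact v : sE V (zact v) = zact (sE V v) + sE V v.
Proof.
case: V v => car E F H HE HF EF v; rewrite /zact /= linearN linearZ /=.
have /eqP := HE v; rewrite subr_eq => /eqP ->.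
rewrite scalerDr scalerA mulVf ?two_neq0 // scale1r opprD addrAC.
by rewrite addNr add0r.
Qed.

Lemma sF_zact v : sF V (zact v) = zact (sF V v) - sF V v.
Proof.
case: V v => car E F H HE HF EF v; rewrite /zact /= linearN linearZ /=.
have /eqP := HF v; rewrite subr_eq => /eqP ->.
rewrite scalerDr scalerN scalerA mulVf ?two_neq0 // scale1r opprD opprK.
by rewrite addrAC addrN add0r.
Qed.

Lemma EF_comm v : sE V (sF V v) = sF V (sE V v) + sH V v.
Proof. by case: V v => car E F H HE HF EF v /=; rewrite -EF addrCA subrr addr0. Qed.

Lemma half_HH v : (2%:R : CC)^-1 *: sH V (sH V v) = 2%:R *: zact (zact v).
Proof.
have -> : sH V (sH V v) = 2%:R *: (2%:R *: zact (zact v)).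
  by rewrite (sHE (sH V v)) (sHE v) [zact (- _)]linearN /= [zact (_ *: _)]linearZ /= scalerN opprK.
by rewrite [LHS]scalerA mulVf ?two_neq0 // scale1r.
Qed.

(** This form and [casimir_EF] express C through z and one product of E and F. The first gives C at
    once on vectors killed by E, the second on vectors killed by F. *)
Lemma casimir_FE v :
  casimir v = 2%:R *: (sF V (sE V v) + zact (zact v) - zact v).
Proof.
rewrite /casimir half_HH EF_comm sHE.
move: (sF V (sE V v)) (zact v) => x w.
by rewrite scalerBr scalerDr [x - _ + x]addrAC -mulr2n -scaler_nat [RHS]addrAC.
Qed.

Lemma casimir_EF v :
  casimir v = 2%:R *: (sE V (sF V v) + zact (zact v) + zact v).
Proof.
rewrite casimir_FE EF_comm sHE; congr (_ *: _).
by rewrite [in RHS]addrAC scaler_nat mulr2n opprD addrA subrK addrAC.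
Qed.

(** With [casimir_EF] on the left and [casimir_FE] on the right both sides contain EFE, and moving E
    across z^2 - z replaces z by z + 1, which gives z^2 + z. *)
Lemma casimir_E v : casimir (sE V v) = sE V (casimir v).
Proof.
rewrite casimir_EF casimir_FE [RHS]linearZ; congr (_ *: _).
rewrite [RHS](linearB (sE V)) [sE V (_ + _)](linearD (sE V)) /= -addrA.
by rewrite -[RHS]addrA; congr (_ + _); rewrite (sE_zact (zact v)) addrK sE_zact linearD.
Qed.

Lemma casimir_F v : casimir (sF V v) = sF V (casimir v).
Proof.
rewrite casimir_FE casimir_EF [RHS]linearZ; congr (_ *: _).
rewrite [RHS](linearD (sF V)) [sF V (_ + _)](linearD (sF V)) /= -addrA.
by rewrite -[RHS]addrA; congr (_ + _); rewrite (sF_zact (zact v)) subrK sF_zact linearB.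
Qed.

Lemma casimir_z v : casimir (zact v) = zact (casimir v).
Proof.
rewrite !casimir_EF [RHS]linearZ; congr (_ *: _).
by rewrite sF_zact linearB /= sE_zact addrK !(linearD (@zact V)).
Qed.

Lemma casimir_H v : casimir (sH V v) = sH V (casimir v).
Proof. by rewrite !sHE linearN linearZ /= casimir_z. Qed.

(** A second name for [casimir], to carry its linearity over CC[z] next to the one over CC. *)
Definition casimir_z_module : pmod (@zact V) -> pmod (@zact V) := @casimir V.

Fact casimir_z_linear : linear casimir_z_module.
Proof.
move=> p u v; rewrite /casimir_z_module !pmod_scaleE.
rewrite [LHS](linearD (@casimir V)); congr (_ + _).
elim/poly_ind: p u => [|p b IHp] u; first by rewrite !pscale0 [LHS]linear0.
rewrite !pscaleDl !pscaleMX !pscaleC [LHS](linearD (@casimir V)) IHp /=.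
by rewrite casimir_z [X in _ + X = _]linearZ.
Qed.
HB.instance Definition _ := GRing.isLinear.Build {poly CC} (pmod (@zact V))
  (pmod (@zact V)) *:%R casimir_z_module casimir_z_linear.

Hypothesis tfV : torsion_free V.

Let tfV' (a : {poly CC}) (v : pmod (@zact V)) : a != 0 -> a *: v = 0 -> v = 0.
Proof. exact: tfV. Qed.

(* If [sE v = 0] with [v != 0], the vectors [sF^n v] are nonzero Casimir
   eigenvectors for the distinct eigenvalues [2 (z - n) (z - n - 1)]. *)
Lemma sE_injective (P : {poly {poly CC}}) : P != 0 ->
  annihilates casimir_z_module P -> forall v, sE V v = 0 -> v = 0.
Proof.
move=> P0 annP v Ev0; apply/eqP/negPn/negP => v0.
pose lam n : {poly CC} := (2%:R)%:P * (('X - (n%:R)%:P) * ('X - (n.+1%:R)%:P)).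
pose w n := iter n (sF V) v.
have lam_step n : lam n \Po ('X + (-1)%:P) = lam n.+1.
  have shiftX m : ('X - (m%:R)%:P) \Po ('X + (-1)%:P) = 'X - (m.+1%:R)%:P :> {poly CC}.
    rewrite comp_polyB comp_polyX comp_polyC -addrA -polyCN -polyCD -opprD -mulrS.
    by rewrite polyCN.
  by rewrite /lam !comp_polyM !shiftX comp_polyC.
have w_eigen n : casimir_z_module (w n) = lam n *: (w n : pmod (@zact V)).
  elim: n => [|n IHn].
    rewrite /casimir_z_module casimir_FE Ev0 linear0 add0r pmod_scaleE /lam.
    rewrite mul_polyC pscaleZl polyC0 subr0 -pscaleA pscaleX pscaleBl pscaleX pscaleC.
    by rewrite scale1r (linearB (@zact V)).
  rewrite /= /casimir_z_module casimir_F -/(casimir_z_module _) IHn pmod_scaleE.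
  have Fz u : sF V (zact u) = zact (sF V u) + (-1) *: sF V u.
    by rewrite sF_zact scaleN1r.
  by rewrite (pscale_shift Fz) lam_step.
(* At z = 0 the eigenvalue is 2 n (n + 1), which is strictly increasing in n. *)
have lam_inj : injective lam.
  move=> m n /(congr1 (fun p => p.[0])); rewrite !hornerE /= -!mulrA !mulrNN -!natrM.
  move/eqP; rewrite CC_eqr_nat !eqn_mul2l /= => /eqP E.
  by case: (ltngtP m n) => // lt_mn; move: E; nia.
have w0 n : w n != 0.
  elim: n => [//|n IHn]; apply/eqP => Fw0.
  (* If F kills [w n], then C acts on it by 2 z (z + 1) as well as by [lam n]. *)
  have : (lam n - (2%:R)%:P * ('X * ('X + 1%:P))) *: (w n : pmod (@zact V)) = 0.
    rewrite scalerBl -w_eigen /casimir_z_module casimir_EF.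
    rewrite (_ : sF V (w n) = 0) // [sE V 0]linear0 add0r pmod_scaleE.
    rewrite mul_polyC pscaleZl -pscaleA pscaleDl !pscaleX pscaleC scale1r (linearD (@zact V)).
    exact: subrr.
  move=> /tfV' w_eq0; apply/negP: IHn; rewrite negbK; apply/eqP/w_eq0/eqP.
  (* At z = -1 the polynomial 2 z (z + 1) vanishes, while [lam n] takes the value 2 (n + 1) (n +
     2). *)
  move/(congr1 (fun p => p.[-1])) /eqP; rewrite !hornerE /= addNr mulr0 subr0.
  rewrite -!opprD -!mulrA mulrNN -!mulrS -!natrM CC_natr_eq0.
  by [].
(* P(z, C) acts on [w n] as the scalar P(z, lam n) of CC[z], and [w n] is not torsion. So [P] has
   infinitely many roots in the domain CC[z]. *)
have root_lam n : root P (lam n).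
  apply/eqP; apply: contraNeq (w0 n) => /tfV' Plam; apply/eqP/Plam.
  by rewrite -(pscale_eigen _ (w_eigen n)) annP.
have := @max_poly_roots _ _ [seq lam n | n <- iota 0 (size P)] P0.
rewrite size_map size_iota ltnn map_inj_uniq // iota_uniq => H.
suff: false by []; apply: H => //; apply/allP => _ /mapP [n _ ->]; exact: root_lam.
Qed.

Lemma annihilates_shift (P : {poly {poly CC}}) : P != 0 ->
  annihilates casimir_z_module P ->
  annihilates casimir_z_module (map_poly (comp_poly ('X - 1%:P)) P).
Proof.
move=> P0 annP v; apply: (sE_injective P0 annP).
have Ez u : sE V (zact u) = zact (sE V u) + 1 *: sE V u.
  by rewrite sE_zact scale1r.
pose Ef : pmod (@zact V) -> pmod (@zact V) := sE V.
have EfD : {morph Ef : u v / u + v} by move=> x y; rewrite /Ef [LHS](linearD (sE V)).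
have EfZ a u : Ef (a *: u) = comp_poly ('X + 1%:P) a *: Ef u.
  by rewrite !pmod_scaleE /Ef (pscale_shift Ez).
have Efc u : Ef (casimir_z_module u) = casimir_z_module (Ef u).
  by rewrite /Ef /casimir_z_module casimir_E.
rewrite -[LHS]/(Ef _) (pscale_semilinear EfD EfZ Efc) -map_poly_comp.
rewrite (eq_map_poly (_ : _ =1 id)) ?map_poly_id ?annP // => p /=.
by rewrite -comp_polyA comp_polyB comp_polyX comp_polyC addrK comp_polyXr.
Qed.

(* [P - P^sigma], with [sigma] the shift [z -> z - 1], annihilates and has
   coefficients of smaller degree in [z] than [P]; it vanishes only if the
   coefficients of [P] are constant. *)
Lemma constant_annihilator (P : {poly {poly CC}}) : P != 0 ->
    annihilates casimir_z_module P ->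
  exists2 q : {poly CC}, q != 0 & annihilates (@casimir V) q.
Proof.
move=> P0 annP; have [m le_m] : exists m, forall i, (size (P`_i)%R <= m)%N.
  exists (\max_(i < size P) size (P`_i)%R)%N => i.
  case: (ltnP i (size P)) => [lt_i|/(nth_default 0) ->]; last by rewrite size_poly0.
  exact: (leq_bigmax (Ordinal lt_i)).
(* The induction is on a common bound for the sizes in z of all coefficients; the bound 0 leaves
   only P = 0. *)
elim: m => [|m IHm] in P le_m P0 annP *.
  case/eqP: P0; apply/polyP => i; rewrite coef0; apply/eqP.
  by rewrite -size_poly_leq0.
pose D := P - map_poly (comp_poly ('X - 1%:P)) P.
have annD : annihilates casimir_z_module D.
  by move=> v; rewrite pscaleBl annP annihilates_shift // subrr.
have coefDE i : D`_i = P`_i - (P`_i \Po ('X - 1%:P)) by rewrite coefB coef_map.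
have [D0|D0] := eqVneq D 0; last first.
  apply: (IHm D) => // i; rewrite coefDE.
  have [->|Pi0] := eqVneq P`_i 0; first by rewrite comp_poly0 subr0 size_poly0.
  rewrite -ltnS (leq_trans _ (le_m i)) // -polyCN.
  exact: (@size_sub_shift (complex Rdefinitions.R)).
have const_coef i : ((P`_i)`_0)%:P = P`_i.
  have /eqP := coefDE i; rewrite D0 coef0 eq_sym subr_eq0 => /eqP/esym.
  by move/(@shift_fixed_const (complex Rdefinitions.R))/size1_polyC.
pose q := map_poly (coefp 0) P.
have Pq : P = map_poly polyC q.
  by apply/polyP => i; rewrite !coef_map /= const_coef.
exists q; first by apply: contraNneq P0 => q0; rewrite Pq q0 rmorph0.
move=> v; rewrite -[RHS](annP v) Pq.
apply: (@pscale_semilinear _ _ (car V) (pmod (@zact V)) (@casimir V)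
  casimir_z_module (@polyC CC) id) => // a u.
by rewrite pmod_scaleE pscaleC.
Qed.

Lemma casimir_annihilator : finite_rank V ->
  exists2 q : {poly CC}, q != 0 & annihilates (@casimir V) q.
Proof.
case=> s sP.
have [|P P0 annP] := @finite_rank_annihilator _ (pmod (@zact V)) casimir_z_module
  tfV' (size s) (fun i => s`_i).
  move=> v; have [p [p0 [qs [_ pv]]]] := sP v; exists p; split=> //.
  by exists (fun i => qs`_i).
exact: constant_annihilator P0 annP.
Qed.

End Sl2.

(** * Submodules and homomorphisms *)

Lemma HE_comm (V : smod) v : sH V (sE V v) - sE V (sH V v) = 2%:R *: sE V v.
Proof. by case: V v. Qed.

Lemma HF_comm (V : smod) v : sH V (sF V v) - sF V (sH V v) = - (2%:R *: sF V v).
Proof. by case: V v. Qed.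

Section Submodule.
Variables (V : smod) (U : car V -> Prop).

(** The algebraic substructures take a boolean predicate, so [U] is reflected classically; the
    closure proof is an argument so that the instance can be attached to the predicate. *)
Definition submod_pred of submod U : {pred car V} := fun v => `[< U v >].

Variable hU : submod U.

Lemma submod_predP v : reflect (U v) (v \in submod_pred hU).
Proof. exact: asboolP. Qed.

Fact submod_pred_closed : GRing.submod_closed (submod_pred hU).
Proof.
have [U0 [UL _]] := hU; split; first exact/submod_predP.
by move=> a u v /submod_predP Uu /submod_predP Uv; apply/submod_predP/UL.
Qed.
HB.instance Definition _ :=
  GRing.isSubmodClosed.Build CC (car V) (submod_pred hU) submod_pred_closed.

Record submod_car := SubmodCar { submod_val : car V; _ : submod_val \in submod_pred hU }.
HB.instance Definition _ := [isSub for submod_val].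
HB.instance Definition _ := [Choice of submod_car by <:].
HB.instance Definition _ := [SubChoice_isSubLmodule of submod_car by <:].

Section Restrict.
Variables (f : {linear car V -> car V}) (fU : forall v, U v -> U (f v)).

Fact restrict_subproof (u : submod_car) : f (val u) \in submod_pred hU.
Proof. by apply/submod_predP/fU/submod_predP/valP. Qed.

Definition restrict (u : submod_car) : submod_car := SubmodCar (restrict_subproof u).

Fact restrict_linear : linear restrict.
Proof. by move=> a u v; apply: val_inj; rewrite /= linearP. Qed.
HB.instance Definition _ :=
  GRing.isLinear.Build CC submod_car submod_car *:%R restrict restrict_linear.
End Restrict.

Definition submodE : {linear submod_car -> submod_car} :=
  restrict (fun v Uv => (hU.2.2 v Uv).1).
Definition submodF : {linear submod_car -> submod_car} :=
  restrict (fun v Uv => (hU.2.2 v Uv).2.1).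
Definition submodH : {linear submod_car -> submod_car} :=
  restrict (fun v Uv => (hU.2.2 v Uv).2.2).

Fact submod_HE u : submodH (submodE u) - submodE (submodH u) = 2%:R *: submodE u.
Proof. by apply: val_inj; rewrite /= HE_comm. Qed.

Fact submod_HF u : submodH (submodF u) - submodF (submodH u) = - (2%:R *: submodF u).
Proof. by apply: val_inj; rewrite /= HF_comm. Qed.

Fact submod_EF u : submodE (submodF u) - submodF (submodE u) = submodH u.
Proof. by apply: val_inj; rewrite /= EF_comm addrAC subrr add0r. Qed.

Definition sub_smod : smod := SMod submod_HE submod_HF submod_EF.

(** Outside this section submodules are handled through this injective homomorphism and its image,
    the same data that describe [W] in the theorem. *)
Definition sub_incl (u : car sub_smod) : car V := submod_val u.

Lemma sub_incl_shom : shom sub_incl.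
Proof. by []. Qed.

Lemma sub_incl_inj : injective sub_incl.
Proof. exact: val_inj. Qed.

Lemma sub_inclP v : U v <-> exists u, sub_incl u = v.
Proof.
split=> [/(submod_predP v) Uv|[u <-]]; first by exists (SubmodCar Uv).
exact/(submod_predP (val u))/valP.
Qed.

End Submodule.

Section Homs.
Variables V W : smod.
Implicit Types f : car V -> car W.

Section OneHom.
Variable f : car V -> car W.
Hypothesis hf : shom f.

Lemma shomD u v : f (u + v) = f u + f v.
Proof. by have := hf.1 1 u v; rewrite !scale1r. Qed.

Lemma shom0 : f 0 = 0.
Proof. by apply: (addrI (f 0)); rewrite -shomD !addr0. Qed.

Lemma shomZ a v : f (a *: v) = a *: f v.
Proof. by have := hf.1 a v 0; rewrite shom0 !addr0. Qed.

Lemma shomB u v : f (u - v) = f u - f v.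
Proof. by rewrite -scaleN1r shomD shomZ scaleN1r. Qed.

Lemma shom_sum (I : Type) (r : seq I) (P : pred I) (F : I -> car V) :
  f (\sum_(i <- r | P i) F i) = \sum_(i <- r | P i) f (F i).
Proof. exact: (big_morph f shomD shom0). Qed.

Lemma shom_zact v : f (zact v) = zact (f v).
Proof. by rewrite /zact -scaleN1r !shomZ hf.2.2.2 scaleN1r. Qed.

Lemma shom_casimir v : f (casimir v) = casimir (f v).
Proof.
by case: hf => _ [fE [fF fH]]; rewrite /casimir !shomD shomZ !(fE, fF, fH).
Qed.

Lemma shom_pscale (z : {linear car V -> car V}) (w : {linear car W -> car W}) p v :
  (forall v, f (z v) = w (f v)) -> f (pscale z p v) = pscale w p (f v).
Proof.
move=> fz; have fZ a u : f (a *: u) = idfun a *: f u by rewrite shomZ.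
by rewrite (@pscale_semilinear _ _ _ _ z w idfun f shomD fZ fz) map_poly_id.
Qed.

Lemma shom_pact p v : f (pact p v) = pact p (f v).
Proof. exact: shom_pscale shom_zact. Qed.

Lemma shom_cact p v : f (pscale (@casimir V) p v) = pscale (@casimir W) p (f v).
Proof. exact: shom_pscale shom_casimir. Qed.

Lemma torsion_free_inj : injective f -> torsion_free W -> torsion_free V.
Proof.
move=> injf tfW p v p0 pv0; apply: injf; rewrite shom0; apply: (tfW p) => //.
by rewrite -shom_pact pv0 shom0.
Qed.

Lemma finite_rank_surj : (forall w, exists v, f v = w) -> finite_rank V -> finite_rank W.
Proof.
move=> surjf [s sP]; exists (map f s) => w; have [v <-] := surjf w.
have [p [p0 [qs [sz_qs pv]]]] := sP v; exists p; split=> //; exists qs.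
rewrite size_map; split=> //; rewrite -shom_pact pv shom_sum.
by apply: eq_bigr => i _; rewrite shom_pact (nth_map 0).
Qed.

End OneHom.
End Homs.

Lemma shom_comp U V W (f : car U -> car V) (g : car V -> car W) :
  shom f -> shom g -> shom (g \o f).
Proof.
move=> [fL [fE [fF fH]]] [gL [gE [gF gH]]].
by do ![split] => *; rewrite /= ?(fL, fE, fF, fH) ?(gL, gE, gF, gH).
Qed.

(** Choice gives [g] pointwise, and injectivity of [i] makes it a homomorphism. *)
Lemma shom_factor U V W (i : car W -> car V) (f : car U -> car V) :
    shom i -> injective i -> shom f -> (forall u, exists w, i w = f u) ->
  exists2 g : car U -> car W, shom g & forall u, i (g u) = f u.
Proof.
move=> hi injI hf /choice [g ig]; exists g => //.
case: (hi) => _ [iE [iF iH]]; case: (hf) => fL [fE [fF fH]].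
do ![split] => *; apply: injI;
  by rewrite ?(shomD hi) ?(shomZ hi) ?(iE, iF, iH) !ig ?(fL, fE, fF, fH).
Qed.

Lemma siso_same_image V W W' (i : car W -> car V) (i' : car W' -> car V) :
    shom i -> shom i' -> injective i -> injective i' ->
    (forall v, (exists w, i w = v) <-> (exists w, i' w = v)) -> siso W W'.
Proof.
move=> hi hi' inji inji' im.
have [w|g hg ig] := shom_factor hi' inji' hi; first by apply/im; exists w.
have [w|h hh ih] := shom_factor hi inji hi'; first by apply/im; exists w.
exists g; split=> //; exists h => w; first by apply: inji; rewrite ih ig.
by apply: inji'; rewrite ig ih.
Qed.

(** * Polynomials in the Casimir operator and generalized eigenspaces *)

Section Cact.
Variable V : smod.
Local Notation cact := (pscale (@casimir V)).

Lemma cact_shom q : shom (cact q).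
Proof.
split=> [a u v|]; first exact: linearP.
have comm (f : {linear car V -> car V}) : (forall v, casimir (f v) = f (casimir v)) ->
    forall v, cact q (f v) = f (cact q v).
  move=> cf v; symmetry.
  have fZ a u : f (a *: u) = idfun a *: f u by rewrite linearZ.
  rewrite (@pscale_semilinear _ _ _ _ (@casimir V) (@casimir V) idfun f (linearD f) fZ).
    by rewrite map_poly_id.
  by move=> u; apply/esym/cf.
by split; [|split]; apply: comm; [exact: casimir_E|exact: casimir_F|exact: casimir_H].
Qed.

Lemma iter_casimir_shift mu n v :
  iter n (casimir_shift mu) v = cact (('X - mu%:P) ^+ n) v.
Proof.
elim: n => [|n IHn]; first by rewrite pscale1.
by rewrite exprS -pscaleA pscaleBl pscaleX pscaleC -IHn.
Qed.

(** The exponent depends on the vector instead of being read off a minimal polynomial, so every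
    homomorphism preserves these parts with no comparison of exponents. *)
Definition gen_part mu v := exists n, iter n (casimir_shift mu) v = 0 :> car V.

Lemma gen_partP mu v :
  gen_part mu v <-> exists n, cact (('X - mu%:P) ^+ n) v = 0.
Proof. by split=> -[n]; exists n; rewrite ?iter_casimir_shift // -iter_casimir_shift. Qed.

Lemma cact_widen mu m n v : (m <= n)%N ->
  cact (('X - mu%:P) ^+ m) v = 0 -> cact (('X - mu%:P) ^+ n) v = 0.
Proof. by move=> le_mn v0; rewrite -(subnK le_mn) exprD -pscaleA v0 linear0. Qed.

Lemma submod_cact_ker q : submod (fun v => cact q v = 0).
Proof.
have hq := cact_shom q; split; first by rewrite linear0.
split=> [a u v u0 v0|v v0]; first by rewrite linearP /= u0 v0 scaler0 addr0.
by case: hq => _ [-> [-> ->]]; rewrite v0 !linear0.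
Qed.

Lemma gen_submod mu : submod (gen_part mu).
Proof.
split; first by exists 0%N.
split=> [a u v /gen_partP [m um] /gen_partP [n vn]|v /gen_partP [n vn]].
  apply/gen_partP; exists (m + n)%N; rewrite linearP /=.
  by rewrite (cact_widen _ um) ?leq_addr // (cact_widen _ vn) ?leq_addl // scaler0 addr0.
have [_ [_ cl]] := submod_cact_ker (('X - mu%:P) ^+ n).
by have [? [? ?]] := cl v vn; do ![split]; apply/gen_partP; exists n.
Qed.

Lemma cact_coprime p q v : coprimep p q -> cact p v = 0 -> cact q v = 0 -> v = 0.
Proof.
move=> /Bezout_eq1_coprimepP [[a b] /= ab1] pv qv.
by rewrite -[v](pscale1 (@casimir V)) -ab1 pscaleDl -!pscaleA pv qv !linear0 addr0.
Qed.

Hypothesis tV : tffr V.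

(** The full multiplicity of [mu] is split off an annihilator. The value n = 0 is allowed, so [mu]
    need not be an eigenvalue. *)
Lemma casimir_split mu : exists n q,
  ~~ root q mu /\ annihilates (@casimir V) (('X - mu%:P) ^+ n * q).
Proof.
have [p p0 pV] := casimir_annihilator tV.1 tV.2.
have [n [q qmu pq]] := multiplicity_XsubC p mu; exists n, q.
by rewrite p0 in qmu; split=> //; rewrite mulrC -pq.
Qed.

End Cact.

Local Notation cact V := (pscale (@casimir V)).

Lemma coprimep_expXsubC mu n (q : {poly CC}) : ~~ root q mu ->
  coprimep (('X - mu%:P) ^+ n) q.
Proof. by move=> qmu; apply: coprimep_expl; rewrite coprimep_sym coprimep_XsubC. Qed.

(* The idempotent [s q(C)] projects onto [ker p(C)] along [ker q(C)]. *)
Lemma cact_projector V (p q : {poly CC}) : coprimep p q ->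
    annihilates (@casimir V) (p * q) ->
  exists s, (forall v, cact V p (cact V (s * q) v) = 0) /\
            (forall W w, cact W p w = 0 -> cact W (s * q) w = w) /\
            (forall v, cact V (s * q) v = 0 -> cact V q v = 0).
Proof.
move=> cpq pq0; have [[r s] /= rs1] := Bezout_eq1_coprimepP _ _ cpq.
exists s; split=> [v|].
  by rewrite pscaleA mulrCA -pscaleA pq0 linear0.
have rsv W (w : car W) : cact W (r * p) w + cact W (s * q) w = w.
  by rewrite -pscaleDl rs1 pscale1.
(* The first clause rests on r p + s q = 1 alone and thus holds on every module [W]; [ses_gen]
   applies it to the quotient. *)
split=> [W w w0|v v0]; first by rewrite -[RHS]rsv -(pscaleA _ r) w0 linear0 add0r.
by rewrite -[v]rsv v0 addr0 pscaleA mulrCA [q * p]mulrC -pscaleA pq0 linear0.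
Qed.

(** The kernel of p(C) embeds in [V], which gives torsion freeness, and the projector maps [V] onto
    it, which gives finite rank. *)
Lemma tffr_summand V W (i : car W -> car V) (p q : {poly CC}) :
    tffr V -> coprimep p q -> annihilates (@casimir V) (p * q) ->
    shom i -> injective i -> (forall v, cact V p v = 0 <-> exists w, i w = v) ->
  tffr W.
Proof.
move=> [tfV frV] cpq pq0 hi inji im; split; first exact: torsion_free_inj hi inji tfV.
have [s [s0 [sp _]]] := cact_projector cpq pq0.
have [v|g hg ig] := shom_factor hi inji (@cact_shom V (s * q)); first exact/im.
apply: (finite_rank_surj hg) frV => w; exists (i w); apply: inji.
by rewrite ig sp //; apply/im; exists w.
Qed.

Section GenSmod.
Variables (mu : CC) (V : smod).

Definition gen_smod : smod := sub_smod (@gen_submod V mu).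
Definition gen_incl : car gen_smod -> car V := @sub_incl _ _ (@gen_submod V mu).

Lemma gen_incl_shom : shom gen_incl.
Proof. exact: sub_incl_shom. Qed.

Lemma gen_incl_inj : injective gen_incl.
Proof. exact: sub_incl_inj. Qed.

Lemma gen_inclP v : gen_part mu v <-> exists u, gen_incl u = v.
Proof. exact: sub_inclP. Qed.

Lemma gen_part_incl u : gen_part mu (gen_incl u).
Proof. by apply/gen_inclP; exists u. Qed.

(** If (C - mu)^m kills v, then (C - mu)^n v is killed both by (C - mu)^m and by q(C). These are
    coprime, so the exponent n suffices for all v. *)
Lemma gen_part_ker n (q : {poly CC}) : ~~ root q mu ->
    annihilates (@casimir V) (('X - mu%:P) ^+ n * q) ->
  forall v : car V, gen_part mu v <-> cact V (('X - mu%:P) ^+ n) v = 0.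
Proof.
move=> qmu pq0 v; split=> [/gen_partP [m vm]|v0]; last by apply/gen_partP; exists n.
apply: (cact_coprime (coprimep_expXsubC m qmu)).
  by rewrite pscaleA mulrC -pscaleA vm linear0.
by rewrite pscaleA mulrC pq0.
Qed.

Lemma gen_smod_Cmu : tffr V -> Cmu mu gen_smod.
Proof.
move=> tV; have [n [q [qmu pq0]]] := casimir_split tV mu; split.
  apply: (tffr_summand tV (coprimep_expXsubC n qmu) pq0 gen_incl_shom gen_incl_inj).
  by move=> v; rewrite -(gen_part_ker qmu pq0); exact: gen_inclP.
exists n => u; rewrite iter_casimir_shift; apply: gen_incl_inj.
rewrite (shom_cact gen_incl_shom) (shom0 gen_incl_shom).
exact/(gen_part_ker qmu pq0)/gen_part_incl.
Qed.

Lemma gen_smod_trivial q : annihilates (@casimir V) q -> ~~ root q mu ->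
  forall u : car gen_smod, u = 0.
Proof.
move=> q0 qmu u; apply: gen_incl_inj; rewrite (shom0 gen_incl_shom).
have /gen_partP [n un] := gen_part_incl u.
exact: (cact_coprime (coprimep_expXsubC n qmu) un).
Qed.

End GenSmod.

Lemma shom_gen_part V W (f : car V -> car W) mu v :
  shom f -> gen_part mu v -> gen_part mu (f v).
Proof.
move=> hf /gen_partP [n v0]; apply/gen_partP; exists n.
by rewrite -(shom_cact hf) v0 (shom0 hf).
Qed.

Lemma shom_gen V W (f : car V -> car W) mu : shom f ->
  exists2 g : car (gen_smod mu V) -> car (gen_smod mu W), shom g &
    forall u, gen_incl (g u) = f (gen_incl u).
Proof.
move=> hf; apply: (shom_factor (@gen_incl_shom mu W) (@gen_incl_inj mu W)).
  exact: shom_comp (gen_incl_shom _ _) hf.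
by move=> u; apply/gen_inclP/(shom_gen_part hf)/gen_part_incl.
Qed.

(** Only surjectivity takes work: a preimage in [B] is replaced by its projection to the [mu]-part.
    The projector is a polynomial in C, so it commutes with [p], and it fixes the given element of
    the [mu]-part of [C]. *)
Lemma ses_gen A B C (i : car A -> car B) (p : car B -> car C) mu : tffr B ->
  ses i p -> exists i' p', @ses (gen_smod mu A) (gen_smod mu B) (gen_smod mu C) i' p'.
Proof.
move=> tB [hi [hp [inji [surjp ex]]]].
have [i' hi' ii'] := shom_gen mu hi; have [p' hp' pp'] := shom_gen mu hp.
exists i', p'; do ![split=> //].
- by move=> x y /(congr1 (@gen_incl mu B)); rewrite !ii' => /inji/gen_incl_inj.
- move=> c; have [b pb] := surjp (gen_incl c).
  have /gen_partP [m cm] := gen_part_incl c.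
  have [n [q [qmu pq0]]] := casimir_split tB mu.
  (* The exponent is raised by m so that the projector fixes [c], which is killed by (C - mu)^m. *)
  have pq0' : annihilates (@casimir B) (('X - mu%:P) ^+ (m + n) * q).
    by move=> v; rewrite exprD -mulrA -pscaleA pq0 linear0.
  have [s [s0 [sp _]]] := cact_projector (coprimep_expXsubC (m + n) qmu) pq0'.
  have [b' b'E] : exists b', @gen_incl mu B b' = cact B (s * q) b.
    by apply/(@gen_inclP mu B _)/gen_partP; exists (m + n)%N.
  exists b'; apply: gen_incl_inj; rewrite pp' b'E (shom_cact hp) pb.
  by apply: (sp C); apply: cact_widen (leq_addr n m) cm.
- move=> p'b0; have : p (gen_incl b) = 0.
    by rewrite -pp' p'b0 (shom0 (gen_incl_shom _ _)).
  case/ex => a ia; have /gen_partP [n bn] := gen_part_incl b.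
  have [a' a'E] : exists a', @gen_incl mu A a' = a.
    apply/(@gen_inclP mu A a)/gen_partP; exists n; apply: inji.
    by rewrite (shom_cact hi) ia bn (shom0 hi).
  by exists a'; apply: gen_incl_inj; rewrite ii' a'E.
- case=> a <-; apply: gen_incl_inj; rewrite pp' ii' (shom0 (gen_incl_shom _ _)).
  by apply/ex; exists (gen_incl a).
Qed.

(* [V'] is [ker q(C)], the complement of the [mu]-part; tffr passes to it because
   it is also a quotient of [V]. *)
Lemma split_off V mu n (q : {poly CC}) : tffr V -> ~~ root q mu ->
    annihilates (@casimir V) (('X - mu%:P) ^+ n * q) ->
  exists V' (j : car V' -> car V), tffr V' /\ annihilates (@casimir V') q /\
    (exists i p, @ses (gen_smod mu V) V V' i p) /\
    forall nu, nu != mu -> siso (gen_smod nu V') (gen_smod nu V).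
Proof.
move=> tV qmu pq0; pose P := ('X - mu%:P) ^+ n.
have hU := @submod_cact_ker V q.
pose V' := sub_smod hU; pose j : car V' -> car V := @sub_incl _ _ hU.
have hj : shom j by exact: sub_incl_shom.
have injj : injective j by exact: sub_incl_inj.
have jP v : cact V q v = 0 <-> exists u, j u = v := @sub_inclP _ _ hU v.
have cqp : coprimep q P by rewrite coprimep_sym coprimep_expXsubC.
have qp0 : annihilates (@casimir V) (q * P) by rewrite mulrC.
have kerP := gen_part_ker qmu pq0.
exists V', j; split; first exact: tffr_summand tV cqp qp0 hj injj jP.
split.
  by move=> u; apply: injj; rewrite (shom_cact hj) (shom0 hj); apply/jP; exists u.
split.
  (* With the roles exchanged, s P(C) projects onto the kernel of q(C), and its own kernel is the
     [mu]-part. *)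
  have [s [s0 [sp sk]]] := cact_projector cqp qp0.
  have [v|g hg jg] := shom_factor hj injj (@cact_shom V (s * P)); first exact/jP.
  exists (@gen_incl mu V), g; split; first exact: gen_incl_shom.
  split=> //; split; first exact: gen_incl_inj.
  split=> [u|v].
    by exists (j u); apply: injj; rewrite jg sp //; apply/jP; exists u.
  rewrite -(@gen_inclP mu V v) kerP; split=> [gv0|v0].
    by apply: sk; rewrite -jg gv0 (shom0 hj).
  by apply: injj; rewrite jg (shom0 hj) -pscaleA v0 linear0.
move=> nu nu_mu; have hgj := shom_comp (gen_incl_shom nu V') hj.
apply: (siso_same_image hgj (gen_incl_shom nu V)).
- exact: inj_comp injj (@gen_incl_inj nu V').
- exact: gen_incl_inj.
move=> v; rewrite -(@gen_inclP nu V v); split=> [[u <-]|gv].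
  exact/(shom_gen_part hj)/gen_part_incl.
(* q(C) v is killed by powers of both C - nu and C - mu, hence vanishes, so v lies in the
   complement. *)
have [u ju] : exists u, j u = v.
  have /gen_partP [m vm] := gv; apply/jP.
  apply: (@cact_coprime V (('X - nu%:P) ^+ m) P).
  - apply: coprimep_expl; rewrite coprimep_sym; apply: coprimep_expl.
    by rewrite coprimep_XsubC root_XsubC.
  - by rewrite pscaleA mulrC -pscaleA vm linear0.
  - by rewrite pscaleA; apply: pq0.
have [w wE] : exists w, @gen_incl nu V' w = u.
  apply/(@gen_inclP nu V' u)/gen_partP; have /gen_partP [m vm] := gv; exists m.
  by apply: injj; rewrite (shom_cact hj) ju vm (shom0 hj).
by exists w; rewrite /= wE.
Qed.

(** * Formal sums and congruences on them *)

Definition fscale (n : int) (x : fsum) : fsum := [seq (n * c.1, c.2) | c <- x].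

Lemma Permutation_cat_perm (x y : fsum) : Permutation (x ++ y) (y ++ x).
Proof. exact: Permutation_app_comm. Qed.

Lemma Permutation_cat (x x' y y' : fsum) :
  Permutation x x' -> Permutation y y' -> Permutation (x ++ y) (x' ++ y').
Proof. exact: Permutation_app. Qed.

(** The rules shared by [k0eq] and [freq]: all constructors except [k0_ses] and [fr_iso]. *)
Record fsum_congruence (R : fsum -> fsum -> Prop) : Prop := FsumCongruence {
  fc_refl : forall x, R x x;
  fc_sym : forall x y, R x y -> R y x;
  fc_trans : forall y x z, R x y -> R y z -> R x z;
  fc_perm : forall x y, Permutation x y -> R x y;
  fc_app : forall s x y, R x y -> R (s ++ x) (s ++ y);
  fc_merge : forall m n X s, R ((m, X) :: (n, X) :: s) ((m + n, X) :: s);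
  fc_zero : forall X s, R ((0, X) :: s) s }.

Lemma k0eq_congruence P : fsum_congruence (k0eq P).
Proof.
split; [exact: k0_refl|exact: k0_sym| |exact: k0_perm|exact: k0_app|exact: k0_merge|
  exact: k0_zero].
by move=> y x z; apply: k0_trans.
Qed.

Lemma freq_congruence P : fsum_congruence (freq P).
Proof.
split; [exact: fr_refl|exact: fr_sym| |exact: fr_perm|exact: fr_app|exact: fr_merge|
  exact: fr_zero].
by move=> y x z; apply: fr_trans.
Qed.

Section Congruence.
Variables (R : fsum -> fsum -> Prop) (hR : fsum_congruence R).

Lemma fc_catl s x y : R x y -> R (x ++ s) (y ++ s).
Proof.
move=> xy; apply: (fc_trans hR (fc_perm hR (Permutation_cat_perm x s))).
exact: (fc_trans hR (fc_app hR s xy) (fc_perm hR (Permutation_cat_perm s y))).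
Qed.

Lemma fc_cat x x' y y' : R x x' -> R y y' -> R (x ++ y) (x' ++ y').
Proof. by move=> xx' yy'; apply: (fc_trans hR (fc_catl y xx')); apply: fc_app. Qed.

Lemma fscaleD m n x : R (fscale m x ++ fscale n x) (fscale (m + n) x).
Proof.
elim: x => [|[k X] x IHx] /=; first exact: fc_refl.
apply: (fc_trans hR (y := (m * k, X) :: (n * k, X) :: (fscale m x ++ fscale n x))).
  apply: (fc_perm hR); apply: perm_skip.
  exact/Permutation_sym/Permutation_middle.
apply: (fc_trans hR (fc_merge hR _ _ _ _)); rewrite -mulrDl.
exact: (fc_app hR [:: ((m + n) * k, X)] IHx).
Qed.

Lemma fscale0 x : R (fscale 0 x) [::].
Proof.
elim: x => [|[k X] x IHx] /=; first exact: fc_refl.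
by rewrite mul0r; apply: (fc_trans hR (fc_zero hR _ _) IHx).
Qed.

Lemma fscale1 x : fscale 1 x = x.
Proof. by rewrite /fscale -[RHS]map_id; apply: eq_map => -[k X]; rewrite mul1r. Qed.

Lemma fscaleN x : R (fscale (-1) x ++ x) [::].
Proof.
rewrite -{2}[x]fscale1; apply: (fc_trans hR (fscaleD _ _ _)); rewrite addNr.
exact: fscale0.
Qed.

Lemma fc_cancel s x y : R (s ++ x) (s ++ y) -> R x y.
Proof.
have drop z : R (fscale (-1) s ++ (s ++ z)) z.
  by rewrite catA; apply: (fc_catl z (fscaleN s)).
move/(fc_app hR (fscale (-1) s)) => sxy.
exact: (fc_trans hR (fc_sym hR (drop x)) (fc_trans hR sxy (drop y))).
Qed.

(** No closure rule scales a relation: natural multiples come from repeated addition, negative ones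
    from cancelling the positive multiple. *)
Lemma fc_scale n x y : R x y -> R (fscale n x) (fscale n y).
Proof.
move=> xy; have pos (m : nat) : R (fscale m x) (fscale m y).
  elim: m => [|m IHm]; first exact: (fc_trans hR (fscale0 x) (fc_sym hR (fscale0 y))).
  have step z := fscaleD m 1 z; rewrite -addn1 PoszD.
  apply: (fc_trans hR (fc_sym hR (step x))); apply: (fc_trans hR _ (step y)).
  by apply: fc_cat => //; rewrite !fscale1.
case: (intP n) => [|m|m]; first exact: (pos 0%N); first exact: (pos m.+1).
apply: (@fc_cancel (fscale m.+1 x)).
have inv z : R (fscale m.+1 z ++ fscale (- m.+1%:Z) z) [::].
  by apply: (fc_trans hR (fscaleD _ _ _)); rewrite subrr; exact: fscale0.
apply: (fc_trans hR (inv x)); apply: fc_sym => //.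
exact: (fc_trans hR (fc_catl _ (pos m.+1)) (inv y)).
Qed.

End Congruence.

Section Total.
Implicit Type D : dsum.

(** The inverse of the decomposition once [L] contains the support. A repeated level would count
    twice, whence the [uniq] hypotheses and [undup] below. *)
Definition dsum_total D (L : seq CC) : fsum := flatten [seq D mu | mu <- L].

Lemma total_cat D D' L : Permutation (dsum_total (fun mu => D mu ++ D' mu) L)
  (dsum_total D L ++ dsum_total D' L).
Proof.
elim: L => [|mu L IHL]; first exact: perm_nil.
rewrite /dsum_total /= -!catA; apply: Permutation_app_head.
apply: (Permutation_trans (Permutation_cat (Permutation_refl _) IHL)).
rewrite -/(dsum_total D L) !catA; exact: Permutation_cat (Permutation_cat_perm _ _) (Permutation_refl _).
Qed.

Lemma total_scale n D L : dsum_total (fun mu => fscale n (D mu)) L = fscale n (dsum_total D L).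
Proof. by rewrite /fscale /dsum_total map_flatten -map_comp. Qed.

Lemma total_congr R D D' L : fsum_congruence R ->
  {in L, forall mu, R (D mu) (D' mu)} -> R (dsum_total D L) (dsum_total D' L).
Proof.
move=> hR; elim: L => [|mu L IHL] DD'; first exact: fc_refl.
apply: (fc_cat hR); first exact/DD'/mem_head.
by apply: IHL => nu nuL; apply: DD'; rewrite inE nuL orbT.
Qed.

Lemma fvalid_cat P x y : fvalid P x -> fvalid P y -> fvalid P (x ++ y).
Proof. by move=> Px Py; apply/List.Forall_app. Qed.

End Total.

(** * The decomposition isomorphism for an arbitrary choice of components *)

Section Decomposition.
Variables (Rel : (smod -> Prop) -> fsum -> fsum -> Prop) (P : smod -> Prop).
Variables (Pmu : CC -> smod -> Prop) (comp : smod -> dsum).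

Definition decomp (x : fsum) : dsum :=
  fun mu => flatten [seq fscale c.1 (comp c.2 mu) | c <- x].

Lemma decomp_cat x y mu : decomp (x ++ y) mu = decomp x mu ++ decomp y mu.
Proof. by rewrite /decomp map_cat flatten_cat. Qed.

Lemma decomp_cons n X x mu : decomp ((n, X) :: x) mu = fscale n (comp X mu) ++ decomp x mu.
Proof. by []. Qed.

Hypothesis hRel : forall Q, fsum_congruence (Rel Q).

Lemma decomp_perm x y mu : Permutation x y -> Permutation (decomp x mu) (decomp y mu).
Proof.
elim=> [|c x' y' _ IH|c d x'|x' y' z' _ IH1 _ IH2] //.
- exact: Permutation_app_head.
- rewrite /decomp /= !catA; exact: Permutation_cat (Permutation_cat_perm _ _) (Permutation_refl _).
- exact: Permutation_trans IH1 IH2.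
Qed.

Lemma decomp_merge m n X x mu :
  Rel (Pmu mu) (decomp ((m, X) :: (n, X) :: x) mu) (decomp ((m + n, X) :: x) mu).
Proof.
by rewrite !decomp_cons catA; apply: (fc_catl (hRel _)); apply: fscaleD.
Qed.

Lemma decomp_zero X x mu : Rel (Pmu mu) (decomp ((0, X) :: x) mu) (decomp x mu).
Proof. by rewrite decomp_cons; apply: (fc_catl (hRel _) _ (fscale0 (hRel _) _)). Qed.

Hypothesis comp_valid : forall V, dvalid Pmu (comp V).
Hypothesis decomp_rel : forall x y mu, Rel P x y -> Rel (Pmu mu) (decomp x mu) (decomp y mu).
Hypothesis PmuP : forall mu V, Pmu mu V -> P V.
Hypothesis Rel_mono : forall mu x y, Rel (Pmu mu) x y -> Rel P x y.
(** Quantifying over all larger lists lets the lists of several objects be merged into one. *)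
Hypothesis comp_total : forall V, P V -> exists L : seq CC, forall L' : seq CC, uniq L' ->
  {subset L <= L'} -> Rel P [:: (1, V)] (dsum_total (comp V) L').
Hypothesis comp_pure : forall mu V, Pmu mu V ->
  forall nu, Rel (Pmu nu) (comp V nu) (if nu == mu then [:: (1, V)] else [::]).

Lemma fvalid_scale Q n x : fvalid Q x -> fvalid Q (fscale n x).
Proof. by elim=> [|c y Qc _ IH]; constructor. Qed.

Lemma decomp_valid x : dvalid Pmu (decomp x).
Proof.
elim: x => [|[n V] x [vx [L Lx]]]; first by split=> [mu|]; [constructor|exists [::]].
have [vV [LV LVx]] := comp_valid V; split=> [mu|].
  by rewrite decomp_cons; apply: fvalid_cat (vx mu); apply: fvalid_scale.
exists (LV ++ L) => mu; rewrite mem_cat negb_or => /andP [muV mux].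
by rewrite decomp_cons Lx // LVx.
Qed.

(** This composite yields injectivity; the opposite one, [decomp_total], yields surjectivity. *)
Lemma total_decomp x : fvalid P x -> exists L : seq CC, forall L' : seq CC, uniq L' ->
  {subset L <= L'} -> Rel P x (dsum_total (decomp x) L').
Proof.
elim=> [|[n V] y PV _ [L IH]].
  exists [::] => L' _ _; suff -> : dsum_total (decomp [::]) L' = [::] by exact: fc_refl.
  by rewrite /dsum_total /decomp /=; elim: L'.
have [LV LVP] := comp_total PV; exists (LV ++ L) => L' uL' sL'.
have {}IH : Rel P y (dsum_total (decomp y) L').
  by apply: IH => // mu muL; apply: sL'; rewrite mem_cat muL orbT.
have {}LVP : Rel P [:: (1, V)] (dsum_total (comp V) L').
  by apply: LVP => // mu muL; apply: sL'; rewrite mem_cat muL.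
apply: (fc_trans (hRel _) _ (fc_perm (hRel _) (Permutation_sym (total_cat _ _ _)))).
rewrite total_scale -cat1s; apply: fc_cat => //.
by have := fc_scale (hRel _) n LVP; rewrite /= mulr1.
Qed.

Lemma total_mono D D' L : (forall mu, Rel (Pmu mu) (D mu) (D' mu)) ->
  Rel P (dsum_total D L) (dsum_total D' L).
Proof. by move=> DD'; apply: (total_congr (hRel P)) => mu _; apply: Rel_mono (DD' mu). Qed.

Lemma decomp_pure mu nu x : fvalid (Pmu mu) x ->
  Rel (Pmu nu) (decomp x nu) (if nu == mu then x else [::]).
Proof.
elim=> [|[n V] y PV _ IH]; first by rewrite if_same; exact: fc_refl.
rewrite decomp_cons.
rewrite (_ : (if _ then _ else _) =
  fscale n (if nu == mu then [:: (1, V)] else [::]) ++ (if nu == mu then y else [::])).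
  by apply: fc_cat => //; apply: fc_scale => //; apply: comp_pure.
by case: eqP => //= _; rewrite mulr1.
Qed.

Lemma decomp_total D L mu : uniq L -> (forall mu, fvalid (Pmu mu) (D mu)) ->
  Rel (Pmu mu) (decomp (dsum_total D L) mu) (if mu \in L then D mu else [::]).
Proof.
move=> uL vD; elim: L uL => [|nu L IHL] /=; first by move=> _; exact: fc_refl.
case/andP=> nuL /IHL {}IHL; rewrite /dsum_total /= decomp_cat inE.
have := fc_cat (hRel _) (decomp_pure mu (vD nu)) IHL.
by case: (eqVneq mu nu) => [->|//]; rewrite (negPf nuL) cats0.
Qed.

Lemma decomp_group_iso : group_iso Rel P Pmu decomp.
Proof.
do ![split].
- by have [] := decomp_valid x.
- by have [] := decomp_valid x.
- by move=> x y _ _ xy mu; apply: decomp_rel.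
- by move=> x y _ _ mu; rewrite decomp_cat; apply: fc_refl.
- move=> x y vx vy xy; have [L LP] := total_decomp vx; have [L' LP'] := total_decomp vy.
  have sub1 : {subset L <= undup (L ++ L')}.
    by move=> mu muL; rewrite mem_undup mem_cat muL.
  have sub2 : {subset L' <= undup (L ++ L')}.
    by move=> mu muL; rewrite mem_undup mem_cat muL orbT.
  apply: (fc_trans (hRel _) (LP _ (undup_uniq _) sub1)).
  apply: (fc_trans (hRel _) (total_mono _ xy)).
  exact: (fc_sym (hRel _) (LP' _ (undup_uniq _) sub2)).
move=> D [vD [L LD]]; exists (dsum_total D (undup L)); split.
  elim: (undup L) => [|mu L' IHL]; first by constructor.
  apply: fvalid_cat IHL; apply: List.Forall_impl (vD mu) => c; exact: PmuP.
move=> mu; have := decomp_total mu (undup_uniq L) vD; rewrite mem_undup.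
by case: ifPn => // /LD ->.
Qed.

End Decomposition.

(** * Decomposition of the Grothendieck group *)

Lemma casimir_roots V : tffr V -> exists r : seq CC,
  annihilates (@casimir V) (\prod_(z <- r) ('X - z%:P)).
Proof.
move=> tV; have [q q0 qV] := casimir_annihilator tV.1 tV.2.
(* Algebraic closedness of CC enters here; [r] lists the roots with multiplicity. *)
have [r qr] := @closed_field_poly_normal (complex Rdefinitions.R) q.
exists r => v; have := qV v; rewrite qr pscaleZl => /eqP.
by rewrite scaler_eq0 lead_coef_eq0 (negPf q0) => /eqP.
Qed.

Lemma root_prod_expXsubC n (L : seq CC) mu : mu \notin L ->
  ~~ root (\prod_(nu <- L) ('X - nu%:P) ^+ n) mu.
Proof.
move=> muL; rewrite -(big_map (fun nu => ('X - nu%:P) ^+ n) predT id) root_bigmul.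
rewrite all_map; apply/allP => nu nuL /=; case: n => [|n]; first by rewrite expr0 rootC oner_eq0.
by rewrite root_exp_XsubC; apply: contraNneq muL => ->.
Qed.

(** [size r] bounds every multiplicity in [r], so a single exponent serves all levels, and [L] can
    be any list containing the roots, as [comp_total] demands. *)
Lemma annihilates_widen V (r L : seq CC) : {subset r <= L} ->
    annihilates (@casimir V) (\prod_(z <- r) ('X - z%:P)) ->
  annihilates (@casimir V) (\prod_(mu <- L) ('X - mu%:P) ^+ size r).
Proof.
move=> rL r0 v; rewrite prodrXl.
suff /dvdpP [s ->] : \prod_(z <- r) ('X - z%:P) %| (\prod_(mu <- L) ('X - mu%:P)) ^+ size r.
  by rewrite -pscaleA r0 linear0.
elim: r rL {r0} => [|z r IHr] rL; first by rewrite big_nil dvd1p.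
rewrite big_cons exprS dvdp_mul ?IHr // => [|x xr]; last by rewrite rL // inE xr orbT.
by rewrite dvdp_XsubCl root_prod_XsubC rL // mem_head.
Qed.

Definition trivial_smod (V : smod) := forall v : car V, v = 0.

Lemma trivial_smod_Cmu mu V : trivial_smod V -> Cmu mu V.
Proof.
move=> V0; split; last by exists 0%N.
split=> [p v _ _|]; first exact: V0.
exists [::] => v; exists 1; rewrite oner_neq0; split=> //; exists [::]; split=> //.
by rewrite big_ord0.
Qed.

(** The zero module is cut out of [V] as the kernel of the constant polynomial 1 in C, that is, of
    the identity. *)
Lemma exists_trivial_smod (V : smod) : exists Z, trivial_smod Z.
Proof.
pose hU := @submod_cact_ker V 1.
exists (sub_smod hU) => u; apply: (@sub_incl_inj V _ hU).
rewrite (shom0 (sub_incl_shom hU)) -[LHS](pscale1 (@casimir V)).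
by apply/(@sub_inclP V _ hU); exists u.
Qed.

(** For Z = 0 the two identity maps form an exact sequence, so [Z] = [Z] + [Z]. *)
Lemma k0_trivial (Q : smod -> Prop) Z : Q Z -> trivial_smod Z -> k0eq Q [:: (1, Z)] [::].
Proof.
move=> QZ Z0; apply: (fc_cancel (k0eq_congruence Q) (s := [:: (1, Z)])).
apply: k0_sym; apply: (@k0_ses Q Z Z Z id id [::]) => //.
have hid : @shom Z Z id by do ![split].
split=> //; split=> //; split=> //; split=> [c|b]; first by exists c.
by split=> _; [exists b|exact: Z0].
Qed.

(** An isomorphism is a short exact sequence whose quotient is zero. *)
Lemma k0_siso (Q : smod -> Prop) X Y : (forall Z, trivial_smod Z -> Q Z) ->
  Q X -> Q Y -> siso X Y -> k0eq Q [:: (1, X)] [:: (1, Y)].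
Proof.
move=> Q0 QX QY [f [hf [g fg gf]]]; have [Z Z0] := exists_trivial_smod X; have QZ := Q0 Z Z0.
apply: k0_sym; apply: (k0_trans (y := [:: (1, X); (1, Z)])).
  apply: (@k0_ses Q X Y Z f (fun=> 0)) => //; split=> //; split.
    by do ![split] => *; apply/esym/Z0.
  split; first exact: can_inj fg.
  split=> [c|b]; first by exists 0; rewrite [c]Z0.
  by split=> // _; exists (g b); rewrite gf.
exact: (k0_app [:: (1, X)] (k0_trivial QZ Z0)).
Qed.

Lemma k0_mono (Q Q' : smod -> Prop) : (forall X, Q X -> Q' X) ->
  forall x y, k0eq Q x y -> k0eq Q' x y.
Proof.
move=> QQ' x y; elim=> {x y}.
- exact: k0_refl.
- by move=> *; apply: k0_sym.
- by move=> x y z _ xy _ yz; apply: k0_trans xy yz.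
- exact: k0_perm.
- by move=> *; apply: k0_app.
- exact: k0_merge.
- exact: k0_zero.
- by move=> A B C i p s QA QB QC; apply: k0_ses; apply: QQ'.
Qed.

(* Objects that are not tffr go to [::] because chains of [k0eq] steps between valid
   sums may pass through them, and zero summands are dropped because [dvalid] asks
   for finite support on the nose. *)
Definition gen_comp (V : smod) : dsum := fun mu =>
  if `[< tffr V /\ ~ trivial_smod (gen_smod mu V) >] then [:: (1, gen_smod mu V)] else [::].

Lemma gen_compE (Q : smod -> Prop) V mu : tffr V -> Q (gen_smod mu V) ->
  k0eq Q (gen_comp V mu) [:: (1, gen_smod mu V)].
Proof.
move=> tV QV; rewrite /gen_comp; case: asboolP => [_|nt]; first exact: k0_refl.
apply: k0_sym; apply: k0_trivial => //; apply: contrapT => V0; exact: nt.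
Qed.

Lemma gen_comp_valid V : dvalid Cmu (gen_comp V).
Proof.
have [tV|ntV] := pselect (tffr V); last first.
  have E mu : gen_comp V mu = [::] by rewrite /gen_comp; case: asboolP => // -[].
  by split=> [mu|]; [rewrite E; constructor|exists [::]].
split=> [mu|].
  rewrite /gen_comp; case: asboolP => _; last by constructor.
  by constructor; [exact: gen_smod_Cmu|constructor].
have [r r0] := casimir_roots tV; exists r => mu mur; rewrite /gen_comp.
case: asboolP => // -[_ []]; apply: (gen_smod_trivial r0).
by rewrite root_prod_XsubC.
Qed.

Lemma gen_comp_ses A B C (i : car A -> car B) (p : car B -> car C) mu :
    tffr A -> tffr B -> tffr C -> ses i p ->
  k0eq (Cmu mu) (gen_comp B mu) (gen_comp A mu ++ gen_comp C mu).
Proof.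
move=> tA tB tC ex; have [i' [p' ex']] := ses_gen mu tB ex.
have CA := gen_smod_Cmu mu tA; have CB := gen_smod_Cmu mu tB.
have CC' := gen_smod_Cmu mu tC; have hC := k0eq_congruence (Cmu mu).
apply: (k0_trans (gen_compE tB CB)); apply: (k0_trans (k0_ses [::] CA CB CC' ex')).
exact: (fc_sym hC (fc_cat hC (gen_compE tA CA) (gen_compE tC CC'))).
Qed.

Lemma gen_decomp_rel x y mu : k0eq tffr x y ->
  k0eq (Cmu mu) (decomp gen_comp x mu) (decomp gen_comp y mu).
Proof.
have hC := k0eq_congruence; elim=> {x y}.
- by move=> x; apply: k0_refl.
- by move=> x y _; apply: k0_sym.
- by move=> x y z _ xy _ yz; apply: k0_trans xy yz.
- by move=> x y xy; apply/k0_perm/decomp_perm.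
- by move=> s x y _ xy; rewrite !decomp_cat; apply: k0_app.
- by move=> *; apply: (@decomp_merge k0eq Cmu gen_comp hC).
- by move=> *; apply: (@decomp_zero k0eq Cmu gen_comp hC).
- move=> A B C i p s tA tB tC ex; rewrite !decomp_cons !fscale1 catA.
  exact: (fc_catl (hC _) _ (gen_comp_ses _ tA tB tC ex)).
Qed.

Lemma gen_comp_siso V V' mu : tffr V -> tffr V' -> siso (gen_smod mu V') (gen_smod mu V) ->
  k0eq tffr (gen_comp V' mu) (gen_comp V mu).
Proof.
move=> tV tV' iso.
have [tg _] := gen_smod_Cmu mu tV; have [tg' _] := gen_smod_Cmu mu tV'.
apply: (k0_trans (gen_compE tV' tg')); apply: (k0_trans (y := [:: (1, gen_smod mu V)])).
  by apply: k0_siso => // Z Z0; have [] := trivial_smod_Cmu mu Z0.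
exact: k0_sym (gen_compE tV tg).
Qed.

(** Induction on the levels: [split_off] removes the part at [mu], and the complement is annihilated
    by the remaining factors and has the same parts at all other levels. *)
Lemma gen_comp_total_annihilated n (L : seq CC) V : uniq L -> tffr V ->
    annihilates (@casimir V) (\prod_(mu <- L) ('X - mu%:P) ^+ n) ->
  k0eq tffr [:: (1, V)] (dsum_total (gen_comp V) L).
Proof.
have hT := k0eq_congruence tffr.
elim: L V => [|mu L IHL] V /= => [_|/andP [muL uL]] tV.
  rewrite big_nil => V0; apply: k0_trivial => // v.
  by rewrite -[LHS](pscale1 (@casimir V)); apply: V0.
rewrite big_cons => V0.
have [V' [j [tV' [V'0 [[i [p ex]] iso]]]]] := split_off tV (root_prod_expXsubC n muL) V0.
have [tg _] := gen_smod_Cmu mu tV.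
apply: (k0_trans (k0_ses [::] tg tV tV' ex)).
rewrite -cat1s; apply: (fc_cat hT); first exact: (k0_sym (gen_compE tV tg)).
apply: (k0_trans (IHL _ uL tV' V'0)); apply: (total_congr hT) => nu nuL.
by apply: gen_comp_siso => //; apply: iso; apply: contraNneq muL => <-.
Qed.

Lemma gen_comp_total V : tffr V -> exists L : seq CC, forall L' : seq CC, uniq L' ->
  {subset L <= L'} -> k0eq tffr [:: (1, V)] (dsum_total (gen_comp V) L').
Proof.
move=> tV; have [r r0] := casimir_roots tV; exists r => L' uL' rL'.
exact: (gen_comp_total_annihilated uL' tV (annihilates_widen rL' r0)).
Qed.

Lemma gen_comp_image V mu W (i : car W -> car V) : tffr V -> Cmu mu W -> shom i ->
    injective i -> (forall v, gen_part mu v <-> exists w, i w = v) ->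
  k0eq (Cmu mu) (gen_comp V mu) [:: (1, W)].
Proof.
move=> tV CW hi inji im.
have CV := gen_smod_Cmu mu tV; apply: (k0_trans (gen_compE tV CV)).
apply: k0_siso => //; first by move=> Z; apply: trivial_smod_Cmu.
apply: (siso_same_image (@gen_incl_shom mu V) hi (@gen_incl_inj mu V) inji) => v.
by rewrite -im -(@gen_inclP mu V v).
Qed.

Lemma gen_comp_pure mu V : Cmu mu V -> forall nu,
  k0eq (Cmu nu) (gen_comp V nu) (if nu == mu then [:: (1, V)] else [::]).
Proof.
move=> [tV [n V0]] nu; case: eqVneq => [->|nu_mu].
  apply: (@gen_comp_image V mu V id) => //; first by split=> //; exists n.
  by move=> v; split=> _; [exists v|exists n].
have Vn : annihilates (@casimir V) (('X - mu%:P) ^+ n).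
  by move=> v; rewrite -iter_casimir_shift.
apply: (k0_trans (gen_compE tV (gen_smod_Cmu nu tV))).
apply: (k0_trivial (gen_smod_Cmu nu tV)); apply: (gen_smod_trivial Vn).
have := @root_prod_expXsubC n [:: mu] nu; rewrite big_seq1; apply.
by rewrite inE.
Qed.

(** * Purely irreducible modules and their levels *)

Lemma casimir_eigenvector V (r : seq CC) (v : car V) : v != 0 ->
    cact V (\prod_(z <- r) ('X - z%:P)) v = 0 ->
  exists mu (w : car V), w != 0 /\ cact V ('X - mu%:P) w = 0.
Proof.
elim: r v => [|z r IHr] v v0; first by rewrite big_nil pscale1 => /eqP; rewrite (negPf v0).
rewrite big_cons -pscaleA; set w := pscale _ _ v.
(* The linear factors act from the end of the list; the last nonzero vector is an eigenvector for
   the next factor. *)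
by have [w0 _|w0 zw] := eqVneq w 0; [exact: IHr v v0 w0|exists z, w].
Qed.

Lemma cact_XsubC V mu (v : car V) : cact V ('X - mu%:P) v = casimir v - mu *: v.
Proof. by rewrite pscaleBl pscaleX pscaleC. Qed.

Lemma PSpl_level V : PSpl V -> exists mu, PSpl_mu mu V.
Proof.
move=> PV; have [tV [[v v0] irr]] := PV; have [r r0] := casimir_roots tV.
have [mu [w [w0 wmu]]] := casimir_eigenvector v0 (r0 v).
exists mu; split=> // u; apply/eqP; rewrite -subr_eq0 -cact_XsubC; apply/eqP.
apply: (irr _ (@submod_cact_ker V ('X - mu%:P)) _ _ u); last by exists w.
(* Purity of the kernel: C - mu commutes with p(z), and [V] is torsion free. *)
by move=> p {}u p0; rewrite (shom_pact (@cact_shom V ('X - mu%:P))); exact: tV.1.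
Qed.

Lemma PSpl_mu_unique mu nu V : PSpl_mu mu V -> PSpl_mu nu V -> mu = nu.
Proof.
move=> [[_ [[v v0] _]] Vmu] [_ Vnu]; apply/eqP; rewrite -subr_eq0.
have : (mu - nu) *: v == 0 by rewrite scalerBl -Vmu Vnu subrr.
by rewrite scaler_eq0 (negPf v0) orbF.
Qed.

(** The level is tested, not chosen, so the definition is total; modules outside [PSpl] get the
    empty sum at every level. *)
Definition level_comp (V : smod) : dsum :=
  fun mu => if `[< PSpl_mu mu V >] then [:: (1, V)] else [::].

Lemma level_compE mu V : PSpl_mu mu V -> forall nu,
  level_comp V nu = if nu == mu then [:: (1, V)] else [::].
Proof.
move=> Vmu nu; rewrite /level_comp; case: asboolP => [Vnu|nVnu].
  by rewrite (PSpl_mu_unique Vnu Vmu) eqxx.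
by case: eqP => // nu_mu; rewrite nu_mu in nVnu.
Qed.

Lemma level_comp_valid V : dvalid PSpl_mu (level_comp V).
Proof.
split=> [mu|].
  by rewrite /level_comp; case: asboolP => ?; constructor=> //; constructor.
have [[mu Vmu]|nV] := pselect (exists mu, PSpl_mu mu V).
  by exists [:: mu] => nu; rewrite inE (level_compE Vmu) => /negPf ->.
exists [::] => mu _; rewrite /level_comp; case: asboolP => // Vmu.
by case: nV; exists mu.
Qed.

Lemma level_comp_siso X Y n mu : PSpl X -> PSpl Y -> siso X Y ->
  freq (PSpl_mu mu) (fscale n (level_comp X mu)) (fscale n (level_comp Y mu)).
Proof.
move=> PX PY iso; have [f [hf [g fg gf]]] := iso.
have XY : PSpl_mu mu X <-> PSpl_mu mu Y.
  split=> -[_ lev]; split=> // v; last first.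
    by apply: (can_inj fg); rewrite (shom_casimir hf) lev (shomZ hf).
  by rewrite -[v]gf -(shom_casimir hf) lev (shomZ hf).
rewrite /level_comp; case: asboolP => [Xmu|nX]; case: asboolP => [Ymu|nY].
- exact: fr_iso.
- by case: nY; apply/XY.
- by case: nX; apply/XY.
- exact: fr_refl.
Qed.

Lemma level_decomp_rel x y mu : freq PSpl x y ->
  freq (PSpl_mu mu) (decomp level_comp x mu) (decomp level_comp y mu).
Proof.
have hC := freq_congruence; elim=> {x y}.
- by move=> x; apply: fr_refl.
- by move=> x y _; apply: fr_sym.
- by move=> x y z _ xy _ yz; apply: fr_trans xy yz.
- by move=> x y xy; apply/fr_perm/decomp_perm.
- by move=> s x y _ xy; rewrite !decomp_cat; apply: fr_app.
- by move=> *; apply: (@decomp_merge freq PSpl_mu level_comp hC).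
- by move=> *; apply: (@decomp_zero freq PSpl_mu level_comp hC).
- move=> n X Y s PX PY iso; rewrite !decomp_cons.
  exact: (fc_catl (hC _) _ (level_comp_siso n mu PX PY iso)).
Qed.

Lemma freq_mono (Q Q' : smod -> Prop) : (forall X, Q X -> Q' X) ->
  forall x y, freq Q x y -> freq Q' x y.
Proof.
move=> QQ' x y; elim=> {x y}.
- exact: fr_refl.
- by move=> *; apply: fr_sym.
- by move=> x y z _ xy _ yz; apply: fr_trans xy yz.
- exact: fr_perm.
- by move=> *; apply: fr_app.
- exact: fr_merge.
- exact: fr_zero.
- by move=> n X Y s QX QY; apply: fr_iso; apply: QQ'.
Qed.

Lemma total_single V mu (L : seq CC) : uniq L ->
  dsum_total (fun nu => if nu == mu then [:: (1, V)] else [::]) L =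
  if mu \in L then [:: (1, V)] else [::].
Proof.
elim: L => //= nu L IHL /andP [nuL /IHL]; rewrite /dsum_total /= inE [mu == nu]eq_sym => ->.
by have [<-|//] := eqVneq nu mu; rewrite (negPf nuL).
Qed.

Lemma level_comp_total V : PSpl V -> exists L : seq CC, forall L' : seq CC, uniq L' ->
  {subset L <= L'} -> freq PSpl [:: (1, V)] (dsum_total (level_comp V) L').
Proof.
move=> /PSpl_level [mu Vmu]; exists [:: mu] => L' uL' sL'.
have -> : level_comp V = fun nu => if nu == mu then [:: (1, V)] else [::].
  by apply: funext => nu; exact: level_compE.
by rewrite total_single // sL' ?mem_head //; exact: fr_refl.
Qed.

Theorem theorem8p13 :
  (exists Phi : fsum -> dsum,
     group_iso k0eq tffr Cmu Phi /\
     (* Phi([V]) = sum_i [V_{mu_i}], V_mu = generalized Casimir eigenspace *)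
     forall (V : smod), tffr V ->
     forall (mu : CC) (W : smod) (i : car W -> car V),
       Cmu mu W -> shom i -> injective i ->
       (forall v : car V,
          (exists n : nat, iter n (casimir_shift mu) v = 0) <-> exists w, i w = v) ->
       k0eq (Cmu mu) (Phi [:: (1%:Z, V)] mu) [:: (1%:Z, W)]) /\
  (exists Psi : fsum -> dsum,
     group_iso freq PSpl PSpl_mu Psi /\
     forall (V : smod) (mu : CC), PSpl_mu mu V ->
       freq (PSpl_mu mu) (Psi [:: (1%:Z, V)] mu) [:: (1%:Z, V)] /\
       forall nu : CC, nu != mu -> freq (PSpl_mu nu) (Psi [:: (1%:Z, V)] nu) [::]).
Proof.
split.
  exists (decomp gen_comp); split.
    apply: (decomp_group_iso k0eq_congruence gen_comp_valid gen_decomp_rel) => //.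
    - by move=> mu V [].
    - by move=> mu x y; apply: k0_mono => V [].
    - exact: gen_comp_total.
    - exact: gen_comp_pure.
  move=> V tV mu W i CW hi inji im; rewrite decomp_cons fscale1 cats0.
  exact: gen_comp_image tV CW hi inji im.
have pure_level mu V nu : PSpl_mu mu V ->
    freq (PSpl_mu nu) (level_comp V nu) (if nu == mu then [:: (1, V)] else [::]).
  by move=> Vmu; rewrite (level_compE Vmu); exact: fr_refl.
exists (decomp level_comp); split.
  apply: (decomp_group_iso freq_congruence level_comp_valid level_decomp_rel) => //.
  - by move=> mu V [].
  - by move=> mu x y; apply: freq_mono => V [].
  - exact: level_comp_total.
  - by move=> mu V Vmu nu; exact: pure_level.
move=> V mu Vmu; split=> [|nu /negPf nu_mu]; rewrite decomp_cons fscale1 cats0.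
  by have := pure_level _ _ mu Vmu; rewrite eqxx.
by have := pure_level _ _ nu Vmu; rewrite nu_mu.
Qed.
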